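(* Let $\mathbf{s}^l\in\mathbb{Z}^l[m]$. The set of all multicharges $\mathbf{s}'^l\in\mathbb{Z}^l$ such that, for some $l$-partition $\boldsymbol{\lambda}^l$, the pair $(\boldsymbol{\lambda}^l,\mathbf{s}'^l)$ appears as an $e$-core for the Ariki-Koike algebra $\mathcal{H}_n^{\mathbf{s}^l}(\eta)$ when $n$ ranges over all integers $n\ge0$ (that is, $(\boldsymbol{\lambda}^l,\mathbf{s}'^l)$ is the $e$-core of $(\boldsymbol{\mu}^l,\mathbf{s}^l)$ for some $n\ge 0$ and some $l$-partition $\boldsymbol{\mu}^l$ of total size $n$) is exactly $\overline{\mathcal{A}}^l_e[m]$.
   Context: Fix integers $e\ge 2$, $l\ge 1$ and $m\in\mathbb{Z}$. For $r\ge1$, $\Pi^r$ is the set of $r$-partitions ($r$-tuples of partitions), $\boldsymbol{\emptyset}$ is the empty one, and $\mathbb{Z}^r[m]=\{(s_0,\dots,s_{r-1})\in\mathbb{Z}^r:\sum_{i=0}^{r-1}s_i=m\}$. Set $$\overline{\mathcal{A}}^l_e[m]=\{(s_0,\dots,s_{l-1})\in\mathbb{Z}^l[m] : 0\le s_j-s_i\le e\ \text{ for all } 0\le i<j\le l-1\}.$$ Algebra. Let $\eta=\exp(2i\pi/e)$. For $\mathbf{s}^l=(s_0,\dots,s_{l-1})\in\mathbb{Z}^l$, the Ariki-Koike algebra $\mathcal{H}_n^{\mathbf{s}^l}(\eta)$ is the unital associative $\mathbb{C}$-algebra with generators $T_0,\dots,T_{n-1}$ and relations $T_0T_1T_0T_1=T_1T_0T_1T_0$,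 $T_iT_{i+1}T_i=T_{i+1}T_iT_{i+1}$ ($1\le i\le n-2$), $T_iT_j=T_jT_i$ ($|i-j|>1$), $(T_0-\eta^{s_0})(T_0-\eta^{s_1})\cdots(T_0-\eta^{s_{l-1}})=0$, $(T_i-\eta)(T_i+1)=0$ ($1\le i\le n-1$). Its Specht modules are indexed by the $l$-partitions of total size $n$. Symbols. A symbol of charge $m$ is a strictly increasing sequence of integers $(\beta_i)_{i<m}$ with $\beta_j=j$ for all sufficiently negative $j$, identified with the set of its entries. For a partition $\lambda=(\lambda_1\ge\lambda_2\ge\cdots)$ (with $\lambda_k=0$ for large $k$) put $X^m(\lambda)=\{\lambda_j-j+m: j\ge1\}$; this gives a bijection between partitions and symbols of charge $m$. A pair $(\boldsymbol{\lambda},\mathbf{s})\in\Pi^r\times\mathbb{Z}^r$ has $r$-symbol $(X^{s_0}(\lambda^0),\dots,X^{s_{r-1}}(\lambda^{r-1}))$; this is a bijection onto $r$-tuples of symbols. $\tau_e$: for a partition $\lambda$, put $Y^j=\{k\in\mathbb{Z}: j+ke\in X^m(\lambda)\}$ for $0\le j\le e-1$; $\tau_e(\lambda)\in\Pi^e\times\mathbb{Z}^e[m]$ is the pair whose $e$-symbol is $(Y^0,\dots,Y^{e-1})$. $\tau^l$: write each $\beta\in X^m(\lambda)$ uniquely as $\beta=c+ed+elq$ with $0\le c\le e-1$, $0\le d\le l-1$, $q\in\mathbb{Z}$, and let $X_d$ be the set of all $c+eq$ coming from the $\beta$ with this value of $d$; $\tau^l(\lambda)\in\Pi^l\times\mathbb{Z}^l[m]$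 is the pair whose $l$-symbol is $(X_{l-1},X_{l-2},\dots,X_0)$. For fixed $m$, both maps are bijections from the set of partitions. $e$-core. For $\boldsymbol{\mu}^l\in\Pi^l$ and $\mathbf{s}^l\in\mathbb{Z}^l[m]$, write $\tau_e\big((\tau^l)^{-1}(\boldsymbol{\mu}^l,\mathbf{s}^l)\big)=(\boldsymbol{\mu}_e,\mathbf{s}_e)$. The $e$-core of $(\boldsymbol{\mu}^l,\mathbf{s}^l)$ is the pair $\tau^l\big(\tau_e^{-1}(\boldsymbol{\emptyset},\mathbf{s}_e)\big)\in\Pi^l\times\mathbb{Z}^l[m]$. Equivalently, on the $l$-symbol $(X^0,\dots,X^{l-1})$ of $(\boldsymbol{\mu}^l,\mathbf{s}^l)$ perform as long as possible the following operations: move an element $x\in X^c$ with $x\notin X^{c+1}$ from $X^c$ to $X^{c+1}$, for $0\le c\le l-2$; or remove $x$ from $X^{l-1}$ and add $x-e$ to $X^0$ when $x-e\notin X^0$. The final $l$-symbol is that of the $e$-core. *)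

(* Defs.v *)
From HB Require Import structures.
From mathcomp Require Import all_boot all_order all_algebra.
From mathcomp Require Import boolp classical_sets.

Set Implicit Arguments.
Unset Strict Implicit.
Unset Printing Implicit Defensive.

Import Order.TTheory GRing.Theory Num.Theory.
Local Open Scope classical_set_scope.
Local Open Scope ring_scope.

(* A partition is stored as the sequence of its nonzero parts; with 0-based
   indexing, lambda_(j+1) is nth 0%N la j, which is 0 beyond the length. *)
Record partition := Partition {
  parts :> seq nat;
  partsP : sorted geq parts && (0%N \notin parts) }.

HB.instance Definition _ := [isSub for parts].
HB.instance Definition _ := [Equality of partition by <:].

Definition empty_partition : partition := @Partition [::] isT.

Definition multipartition (r : nat) := {ffun 'I_r -> partition}.
Definition multicharge (r : nat) := {ffun 'I_r -> int}.

Definition empty_multipartition (r : nat) : multipartition r :=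
  [ffun=> empty_partition].

Definition total_size (r : nat) (la : multipartition r) : nat :=
  (\sum_(i < r) sumn (la i))%N.

(* Z^r[m]: multicharges of total charge m. *)
Definition charges (r : nat) (m : int) : set (multicharge r) :=
  [set s | \sum_(i < r) s i = m].

Definition closed_alcove (e l : nat) (m : int) : set (multicharge l) :=
  [set s | @charges l m s /\
           forall i j : 'I_l, (i < j)%N -> 0 <= s j - s i <= e%:Z].

(* X^m(la) = {la_j - j + m : j >= 1}; the index j below is shifted by one. *)
Definition symbol (m : int) (la : partition) : set int :=
  [set x | exists j : nat, x = (nth 0%N la j)%:Z - j.+1%:Z + m].

Definition multisymbol (r : nat) (p : multipartition r * multicharge r)
  (i : 'I_r) : set int := symbol (p.2 i) (p.1 i).

(* The graph of tau_e. A pair is determined by its e-symbol, so for fixed m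
   and la this relation holds for exactly one p, namely p = tau_e(la). *)
Definition is_tau_e (e : nat) (m : int) (la : partition)
    (p : multipartition e * multicharge e) : Prop :=
  forall j : 'I_e,
    multisymbol p j = [set k : int | symbol m la (j%:Z + k * e%:Z)].

(* The set X_d of all c + e q such that c + e d + e l q lies in X^m(la). *)
Definition column (e l : nat) (m : int) (la : partition) (d : 'I_l) : set int :=
  [set x | exists (c : 'I_e) (q : int),
     x = c%:Z + e%:Z * q /\
     symbol m la (c%:Z + e%:Z * d%:Z + e%:Z * l%:Z * q)].

(* The graph of tau^l. The l-symbol is (X_{l-1}, ..., X_0), whence rev_ord. *)
Definition is_tau_l (e l : nat) (m : int) (la : partition)
    (p : multipartition l * multicharge l) : Prop :=
  forall i : 'I_l, multisymbol p i = @column e l m la (rev_ord i).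

(* q is the e-core of p: with la = (tau^l)^{-1}(p), (mu_e, s_e) = tau_e(la) and
   ka = tau_e^{-1}(empty, s_e), one has q = tau^l(ka). *)
Definition is_ecore (e l : nat) (m : int)
    (p q : multipartition l * multicharge l) : Prop :=
  exists (la ka : partition) (mu_e : multipartition e) (s_e : multicharge e),
    [/\ is_tau_l e m la p,
        is_tau_e m la (mu_e, s_e),
        is_tau_e m ka (empty_multipartition e, s_e) &
        is_tau_l e m ka q].

(* Main.v *)
Require Import Defs.
From mathcomp Require Import all_boot all_order all_algebra.
From mathcomp Require Import boolp classical_sets.
From mathcomp Require Import zify.

(** Place the beads of a symbol at the integers [c + e (d + l q)] with
    [0 <= c < e] and [0 <= d < l]. The runners of [tau_e] are indexed by [c], the
    columns of [tau^l] by [d], and the set of beads is the union of pieces indexed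
    by the pairs [(c, d)]. Charge is additive over such a decomposition
    ([charged_interleave], [charged_slices]), and the sets having a charge are
    exactly the symbols ([charged_symbol], [symbol_of_charged]); so only charges
    have to be computed.

    An e-core has half-lines [(-oo, t c)] as runners. Its column [d] is the set
    of the [c + e q] with [d + l q < t c]. These columns are nested, and the
    largest one shifted down by [e] is contained in the smallest, whence the
    alcove inequalities by monotonicity of the charge ([ecore_charge_alcove]).

    Conversely, let [s'] be in the alcove. There is a matrix [b] of charges of
    pieces whose column sums are given by [s'] and whose rows are balanced
    ([alcove_balanced_matrix]); by [balanced_interleave] each row describes the
    pieces of a half-line, so the core whose runner charges [t] are the row sums
    of [b] has multicharge [s']. It remains to find a configuration with column
    charges [s] and the runner charges [t]. Since both [s] and [t] have total [m],
    an integer matrix of piece charges with these margins exists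
    ([matrix_margins]), and filling each piece up to the prescribed charge gives
    the configuration. *)

Set Implicit Arguments.
Unset Strict Implicit.
Unset Printing Implicit Defensive.

Import Order.TTheory GRing.Theory Num.Theory.

Local Open Scope classical_set_scope.
Local Open Scope ring_scope.

(** * The charge of a set of integers *)

(** The charge [m] is the number of elements in the window [[-K, K)], minus [K];
    outside of the window the set agrees with the negative integers. *)
Definition charged_at (A : set int) (m : int) (K : nat) : Prop :=
  [/\ forall x : int, x < - K%:Z -> A x,
      forall x : int, K%:Z <= x -> ~ A x &
      (\sum_(i < K.*2) `[< A (i%:Z - K%:Z)%R >])%N%:Z = m + K%:Z].

Definition charged (A : set int) (m : int) : Prop :=
  exists K : nat, charged_at A m K.

Lemma charged_atS (A : set int) (m : int) (K : nat) :
  charged_at A m K -> charged_at A m K.+1.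
Proof.
move=> [lo hi cnt]; split=> [x Hx|x Hx|].
- by apply: lo; lia.
- by apply: hi; lia.
rewrite doubleS big_ord_recl big_ord_recr /=.
have -> : `[< A (0%:Z - K.+1%:Z) >] = true by apply/asboolP/lo; lia.
have -> : `[< A ((bump 0 K.*2)%:Z - K.+1%:Z)%R >] = false.
  by apply/asboolPn/hi; rewrite /bump; lia.
rewrite (eq_bigr (fun i : 'I_K.*2 => nat_of_bool `[< A (i%:Z - K%:Z)%R >])).
  by rewrite addn0 add1n -addn1 PoszD cnt; lia.
by move=> i _; congr (nat_of_bool `[< A _ >]); rewrite /= /bump; lia.
Qed.

Lemma charged_at_widen (A : set int) (m : int) (K K' : nat) :
  (K <= K')%N -> charged_at A m K -> charged_at A m K'.
Proof.
move=> /subnK <- H; elim: (K' - K)%N => [//|n IHn].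
by rewrite addSn; exact: charged_atS.
Qed.

(** Both charges can be computed in a common window, where the larger set has
    more elements. *)
Lemma charged_le (A B : set int) (a b : int) :
  A `<=` B -> charged A a -> charged B b -> a <= b.
Proof.
move=> AB [K HA] [K' HB].
have [_ _ cA] := @charged_at_widen _ _ _ (maxn K K') (leq_maxl _ _) HA.
have [_ _ cB] := @charged_at_widen _ _ _ (maxn K K') (leq_maxr _ _) HB.
suff : (\sum_(i < (maxn K K').*2) `[< A (i%:Z - (maxn K K')%:Z)%R >]
        <= \sum_(i < (maxn K K').*2) `[< B (i%:Z - (maxn K K')%:Z)%R >])%N by lia.
apply: leq_sum => i _; case: asboolP => // /AB HBi.
by rewrite (introT (asboolP _) HBi).
Qed.

Lemma charged_inj (A : set int) (a b : int) : charged A a -> charged A b -> a = b.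
Proof.
move=> Ha Hb.
have := @charged_le A A _ _ (fun x => id) Ha Hb.
have := @charged_le A A _ _ (fun x => id) Hb Ha.
lia.
Qed.

Lemma parts_nonincr (la : Defs.partition) (i j : nat) :
  (i <= j)%N -> (nth 0%N la j <= nth 0%N la i)%N.
Proof.
have /andP[srt _] := partsP la => ij.
have [jl|jl] := ltnP j (size la); last by rewrite (nth_default _ jl).
by apply: (sorted_leq_nth (leT := geq)) => //; rewrite ?inE;
  [move=> x y z /=; lia | move=> x /=; lia | lia].
Qed.

(** The beads of the symbol that are at least [-K] are exactly those of its first
    [m + K] rows, and distinct rows give distinct beads. *)
Lemma charged_symbol (m : int) (la : Defs.partition) : charged (symbol m la) m.
Proof.
(* All integers below [-K] are beads of empty rows, and the first bead is
   below [K]. *)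
pose K := (`|m| + size la + nth 0%N la 0)%N.
exists K; split=> [x Hx|x Hx [j xE]|].
- have jE : (`|(m - 1 - x)%R|%N)%:Z = m - 1 - x by rewrite /K in Hx; lia.
  exists `|(m - 1 - x)%R|%N.
  by rewrite nth_default; [lia | rewrite /K in Hx; lia].
- by have := parts_nonincr la (leq0n j); rewrite /K in Hx; lia.
pose n := `|(m + K%:Z)%R|%N.
have nE : n%:Z = m + K%:Z by rewrite /n /K; lia.
pose f (j : nat) := `|((nth 0%N la j)%:Z - j.+1%:Z + m + K%:Z)%R|%N.
have fE (j : nat) : (j < n)%N -> (f j)%:Z = (nth 0%N la j)%:Z - j.+1%:Z + m + K%:Z.
  by rewrite /f; lia.
rewrite -nE; congr Posz.
rewrite -(big_mkord xpredT (fun i => nat_of_bool `[< symbol m la (i%:Z - K%:Z) >])).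
rewrite -big_mkcond /= sum1_count -size_filter -[RHS](size_mkseq f).
apply/perm_size/uniq_perm.
- by rewrite filter_uniq // iota_uniq.
- rewrite map_inj_in_uniq ?iota_uniq // => i j; rewrite !mem_iota => Hi Hj fij.
  have := fE i ltac:(lia); have := fE j ltac:(lia); rewrite fij.
  have [ij|ij|//] := ltngtP i j.
    by have := parts_nonincr la (ltnW ij); lia.
  by have := parts_nonincr la (ltnW ij); lia.
move=> x; rewrite mem_filter mem_index_iota leq0n /=.
apply/andP/mapP => [[/asboolP[j xE] Hx]|[j]].
  have jn : (j < n)%N.
    have [//|nj] := ltnP j n.
    by have := @nth_default _ 0%N la j; rewrite /K in nE *; lia.
  by exists j; [rewrite mem_iota | have := fE j jn; lia].
rewrite mem_iota => Hj ->; have := fE j ltac:(lia) => fj; split.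
  by apply/asboolP; exists j; lia.
by have := parts_nonincr la (leq0n j); rewrite /K in nE fj *; lia.
Qed.

(** In a nonincreasing sequence the zeros are last, where the default value of
    [nth] restores them. *)
Lemma nth_filter_pos (q : seq nat) (j : nat) :
  sorted geq q -> nth 0%N [seq x <- q | x != 0%N] j = nth 0%N q j.
Proof.
elim: q j => [//|x q IHq] j srt /=.
have [x0|x0] := eqVneq x 0%N; last first.
  by case: j => [//|j] /=; apply: IHq; exact: path_sorted srt.
have /allP q0 : all (geq x) q.
  by apply: order_path_min srt => a b c /=; lia.
have qE : {in q, forall y, y = 0%N} by move=> y /q0 /=; lia.
rewrite (eq_in_filter (a2 := pred0)) => [|y /qE -> //].
rewrite filter_pred0 nth_nil; case: j => [//|j] /=.
have [jq|jq] := ltnP j (size q); last by rewrite nth_default.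
by rewrite (qE _ (mem_nth 0%N jq)).
Qed.

(** A bead determines a row whose length is the number of holes below it. With
    the beads of the window listed in decreasing order as [s], the bead of rank
    [j] has [size s - j.+1] window beads below it, which gives the formula for
    the rows [q]; empty rows are dropped to obtain a partition. *)
Lemma symbol_of_charged (A : set int) (m : int) :
  charged A m -> exists la : Defs.partition, symbol m la = A.
Proof.
move=> [K [lo hi cnt]].
pose s := rev [seq i <- iota 0 K.*2 | `[< A (i%:Z - K%:Z)%R >]].
have mem_s (i : nat) : (i \in s) = (i < K.*2)%N && `[< A (i%:Z - K%:Z)%R >].
  by rewrite mem_rev mem_filter mem_iota andbC.
have srt_s : sorted gtn s.
  by rewrite rev_sorted sorted_filter ?iota_ltn_sorted // => x y z /=; lia.
have size_s : (size s)%:Z = m + K%:Z.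
  rewrite -cnt -(big_mkord xpredT (fun i => nat_of_bool `[< A (i%:Z - K%:Z)%R >])).
  by rewrite -big_mkcond /= sum1_count size_rev size_filter /index_iota subn0.
have decr_s (j : nat) : (j.+1 < size s)%N -> (nth 0%N s j.+1 < nth 0%N s j)%N.
  by move/(sortedP 0%N): srt_s => /[apply].
have low_s (k : nat) : (k < size s)%N -> (k <= nth 0%N s (size s - k.+1))%N.
  elim: k => [//|k IHk] Hk.
  have := decr_s (size s - k.+2)%N ltac:(lia).
  have -> : ((size s - k.+2).+1 = size s - k.+1)%N by lia.
  by have := IHk ltac:(lia); lia.
pose q := mkseq (fun j => nth 0%N s j - (size s - j.+1))%N (size s).
have srt_q : sorted geq q.
  apply/(sortedP 0%N) => j; rewrite size_mkseq => Hj.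
  by rewrite !nth_mkseq //=; [have := decr_s j Hj; lia | lia].
pose p := [seq x <- q | x != 0%N].
have pP : sorted geq p && (0%N \notin p).
  rewrite mem_filter eqxx andbT sorted_filter // => x y z /=; lia.
exists (Partition pP).
have valE (j : nat) : (j < size s)%N ->
    (nth 0%N p j)%:Z - j.+1%:Z + m = (nth 0%N s j)%:Z - K%:Z.
  move=> Hj; rewrite nth_filter_pos // nth_mkseq //.
  have := low_s (size s - j.+1)%N ltac:(lia).
  have -> : (size s - (size s - j.+1).+1 = j)%N by lia.
  by lia.
have valE' (j : nat) : (size s <= j)%N -> nth 0%N p j = 0%N.
  by move=> Hj; rewrite nth_filter_pos // nth_default // size_mkseq.
apply/seteqP; split=> [x [j /= ->]|x Ax].
  have [js|js] := ltnP j (size s); last by rewrite valE' //; apply: lo; lia.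
  by rewrite valE //; have := mem_nth 0%N js; rewrite mem_s => /andP[_ /asboolP].
have [xK|xK] := ltP x (- K%:Z).
  by exists `|(m - 1 - x)%R|%N; rewrite /= valE'; lia.
have xK' : x < K%:Z by case: ltP => // /hi.
have xE : x = `|(x + K%:Z)%R|%N%:Z - K%:Z by lia.
have xs : `|(x + K%:Z)%R|%N \in s.
  by rewrite mem_s -xE; apply/andP; split; [lia | exact/asboolP].
exists (index `|(x + K%:Z)%R|%N s).
by rewrite /= valE ?index_mem // nth_index.
Qed.

(** * Decomposition along residues *)

Definition slice (b : nat) (A : set int) (c : 'I_b) : set int :=
  [set q | A (c%:Z + b%:Z * q)].

Definition interleave (b : nat) (f : 'I_b -> set int) : set int :=
  [set x | exists (c : 'I_b) (q : int), x = c%:Z + b%:Z * q /\ f c q].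

Lemma euclid_inj (b : nat) (c c' : 'I_b) (q q' : int) :
  c%:Z + b%:Z * q = c'%:Z + b%:Z * q' -> c = c' /\ q = q'.
Proof.
move=> H; have Hc := ltn_ord c; have Hc' := ltn_ord c'.
have qq : q = q' by nia.
by split=> //; apply: val_inj; move: H; rewrite qq /=; lia.
Qed.

Lemma interleaveK (b : nat) (f : 'I_b -> set int) (c : 'I_b) :
  slice (interleave f) c = f c.
Proof.
apply/seteqP; split=> [q [c' [q' [/euclid_inj[-> ->]]]] //|q fq].
by exists c, q.
Qed.

Lemma sliceK (b : nat) (A : set int) : (0 < b)%N ->
  interleave (fun c : 'I_b => slice A c) = A.
Proof.
move=> b0; apply/seteqP; split=> [x [c [q [-> //]]]|x Ax].
have b0' : b%:Z != 0 by lia.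
have rlt : (`|((x %% b%:Z)%Z)%R|%N < b)%N.
  by have := modz_ge0 x b0'; have := ltz_pmod x (d := b%:Z) ltac:(lia); lia.
have xE : x = (Ordinal rlt)%:Z + b%:Z * (x %/ b%:Z)%Z.
  by rewrite /= {1}(divz_eq x b%:Z); have := modz_ge0 x b0'; lia.
by exists (Ordinal rlt), (x %/ b%:Z)%Z; split=> //; rewrite /slice /= -xE.
Qed.

Lemma sum_euclid (b n : nat) (F : nat -> nat) :
  (\sum_(i < b * n) F i = \sum_(c < b) \sum_(q < n) F (c + b * q))%N.
Proof.
elim: n => [|n IHn].
  by rewrite muln0 big_ord0 big1 // => c _; rewrite big_ord0.
rewrite -(big_mkord xpredT) mulnS addnC (big_cat_nat (n := (b * n)%N)) //=; last by lia.
rewrite big_mkord IHn -{1}[(b * n)%N]add0n big_addn addKn big_mkord.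
under [RHS]eq_bigr => c _ do rewrite big_ord_recr.
by rewrite big_split.
Qed.

(** Additivity of the charge: the window [[-bK, bK)] of the interleaved set
    consists of the windows [[-K, K)] of the [b] pieces. *)
Lemma charged_interleave (b : nat) (f : 'I_b -> set int) (a : 'I_b -> int) :
  (0 < b)%N -> (forall c, charged (f c) (a c)) ->
  charged (interleave f) (\sum_c a c).
Proof.
move=> b0 /choice[Kf HK]; pose K := (\max_c Kf c)%N.
have {}HK c : charged_at (f c) (a c) K.
  by apply: charged_at_widen (HK c); exact: leq_bigmax.
exists (b * K)%N; split=> [x Hx|x Hx [c [q [xE fq]]]|].
- have : interleave (fun c : 'I_b => slice [set x] c) x by rewrite sliceK.
  move=> [c [q [xE _]]]; exists c, q; split=> //.
  by have [lo _ _] := HK c; apply: lo; nia.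
- by have [_ hi _] := HK c; apply: hi fq; have := ltn_ord c; nia.
rewrite doubleMr.
rewrite (@sum_euclid b K.*2 (fun i => nat_of_bool `[< interleave f (i%:Z - (b * K)%N%:Z) >])).
transitivity (\sum_(c < b) (a c + K%:Z)); last first.
  by rewrite big_split /= sumr_const card_ord -mulr_natr natz PoszM [b%:Z * _]mulrC.
rewrite (big_morph Posz PoszD erefl); apply: eq_bigr => c _.
have [_ _ <-] := HK c; congr Posz; apply: eq_bigr => q _.
congr (nat_of_bool `[< _ >]); rewrite -[in RHS](interleaveK f c) /slice /=.
by congr (interleave f _); lia.
Qed.

Lemma charged_slices (b : nat) (A : set int) (m : int) : (0 < b)%N ->
  charged A m -> exists a : 'I_b -> int,
    (forall c, charged (slice A c) (a c)) /\ \sum_c a c = m.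
Proof.
move=> b0 HA; have [K [lo hi _]] := HA.
pose cnt (c : 'I_b) := (\sum_(i < K.*2) `[< slice A c (i%:Z - K%:Z)%R >])%N.
have Hc c : charged (slice A c) ((cnt c)%:Z - K%:Z).
  exists K; split=> [x Hx|x Hx|]; last by rewrite subrK.
  - by apply: lo; have := ltn_ord c; nia.
  - by apply: hi; nia.
exists (fun c => (cnt c)%:Z - K%:Z); split=> //.
apply: (@charged_inj A) => //.
by rewrite -{1}(@sliceK b A b0); exact: charged_interleave.
Qed.

(** With beads placed at [c + e (d + l q)], the map [tau_e] collects those with
    the same [c] and [tau^l] those with the same [d]; both are unions of the
    pieces indexed by the pairs [(c, d)]. *)
Lemma columnE (e l : nat) (m : int) (la : Defs.partition) (d : 'I_l) :
  @column e l m la d =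
  interleave (fun c : 'I_e => slice (slice (symbol m la) c) d).
Proof.
suff E (c : 'I_e) (q : int) : c%:Z + e%:Z * d%:Z + e%:Z * l%:Z * q
                            = c%:Z + e%:Z * (d%:Z + l%:Z * q).
  apply/seteqP; split=> x [c [q [-> H]]]; exists c, q; split=> //.
    by rewrite /slice /= -E.
  by rewrite E.
by rewrite mulrDr mulrA addrA.
Qed.

(** Both sides are the sum of the charges of all pieces [(c, d)], taken column
    by column or runner by runner. *)
Lemma charges_tau_l (e l : nat) (m : int) (la : Defs.partition)
    (p : multipartition l * multicharge l) : (0 < e)%N -> (0 < l)%N ->
  is_tau_l e m la p -> charges m p.2.
Proof.
move=> e0 l0 tau.
have [r [Hr rm]] := charged_slices e0 (charged_symbol m la).
have /choice[a Ha] c : exists ac : 'I_l -> int,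
    (forall d, charged (slice (slice (symbol m la) c) d) (ac d)) /\
    \sum_d ac d = r c by exact: charged_slices.
rewrite /charges /= (reindex_inj rev_ord_inj) /= -rm.
have pE (d : 'I_l) : p.2 (rev_ord d) = \sum_c a c d.
  apply: (@charged_inj (@column e l m la d)).
    by rewrite -{1}[d]rev_ordK -tau; exact: charged_symbol.
  by rewrite columnE; apply: charged_interleave => // c; exact: (Ha c).1.
under eq_bigr => d _ do rewrite pE.
by rewrite exchange_big; apply: eq_bigr => c _; exact: (Ha c).2.
Qed.

(** * Charges of cores lie in the alcove *)

Lemma symbol_empty (m : int) : symbol m empty_partition = [set x | x < m].
Proof.
apply/seteqP; split=> [x [j /= ->]|x /= Hx]; first by rewrite nth_nil; lia.
by exists `|(m - 1 - x)%R|%N; rewrite nth_nil; lia.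
Qed.

Lemma charged_lt (m : int) : charged [set x | x < m] m.
Proof. by rewrite -symbol_empty; exact: charged_symbol. Qed.

Lemma charged_shift (A : set int) (m : int) (k : int) :
  charged A m -> charged [set x | A (x + k)] (m - k).
Proof.
move=> /symbol_of_charged[la <-].
have -> : [set x | symbol m la (x + k)] = symbol (m - k) la.
  by apply/seteqP; split=> x [j xE]; exists j; lia.
exact: charged_symbol.
Qed.

Lemma tau_e_empty_slice (e : nat) (m : int) (ka : Defs.partition) (t : multicharge e)
    (c : 'I_e) :
  is_tau_e m ka (empty_multipartition e, t) ->
  slice (symbol m ka) c = [set k | k < t c].
Proof.
move=> /(_ c); rewrite /multisymbol /= ffunE symbol_empty => ->.
by rewrite /slice /=; apply/seteqP; split=> k /=; rewrite mulrC.
Qed.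

(** Column [d] of the core with runner charges [t] consists of the
    [c + e y] with [d + l y < t c]. Lowering [d], hence raising the position
    [rev_ord d], enlarges this set; and subtracting [e] from an element, that
    is, lowering [y] by one, compensates any increase of [d], as that is less
    than [l]. *)
Lemma ecore_charge_alcove (e l : nat) (m : int) (ka : Defs.partition)
    (t : multicharge e) (q : multipartition l * multicharge l) :
  (0 < e)%N -> (0 < l)%N ->
  is_tau_e m ka (empty_multipartition e, t) -> is_tau_l e m ka q ->
  @closed_alcove e l m q.2.
Proof.
move=> e0 l0 te tl; split; first exact: charges_tau_l tl.
have colE (i : 'I_l) : symbol (q.2 i) (q.1 i) = [set x | exists (c : 'I_e) (y : int),
    x = c%:Z + e%:Z * y /\ (rev_ord i)%:Z + l%:Z * y < t c].
  have := tl i; rewrite /multisymbol => ->; rewrite columnE.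
  by under eq_fun => c do rewrite (tau_e_empty_slice c te).
move=> i j ij; have Hj := ltn_ord j; apply/andP; split.
  rewrite subr_ge0; apply: (charged_le _ (charged_symbol _ (q.1 i)) (charged_symbol _ (q.1 j))).
  rewrite !colE => x [c [y [-> H]]]; exists c, y; split=> //.
  by move: H => /=; lia.
suff : q.2 j - e%:Z <= q.2 i by lia.
apply: (charged_le _ (charged_shift e%:Z (charged_symbol _ (q.1 j))) (charged_symbol _ (q.1 i))).
rewrite !colE => x [c [y [xE H]]]; exists c, (y - 1); split; first lia.
by move: H => /=; lia.
Qed.

Lemma sum_nat_lt_ord (n k : nat) : (k <= n)%N -> (\sum_(i < n) (i < k) = k)%N.
Proof.
move=> kn; rewrite -(big_mkord xpredT (fun i => nat_of_bool (i < k)%N)) (big_cat_nat (n := k)) //=.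
rewrite [X in (_ + X)%N]big_nat_cond [X in (_ + X)%N]big1 ?addn0; last by move=> i; lia.
rewrite -[RHS]subn0 -[RHS]muln1 -sum_nat_const_nat.
by apply: eq_big_nat => i /andP[_ ->].
Qed.

Lemma sum_int_lt_ord (n k : nat) : (k <= n)%N -> \sum_(i < n) (i < k)%N%:Z = k%:Z.
Proof. by move=> kn; rewrite -(big_morph Posz PoszD erefl) sum_nat_lt_ord. Qed.

(** * Every alcove point is reached *)

(** A half-line of charge [t] shares out its beads evenly among the [l] residues,
    the first residues being served first; so the charges of its slices form the
    nonincreasing sequence with sum [t] and values in some [{u, u + 1}]. In each direction, every term [b i] is
    compared with [q] plus the indicator of an initial segment. *)
Lemma balanced_interleave (l : nat) (b : 'I_l -> int) (d : 'I_l) (q : int) :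
  (forall i j : 'I_l, (i <= j)%N -> b j <= b i <= b j + 1) ->
  (d%:Z + l%:Z * q < \sum_i b i) = (q < b d).
Proof.
move=> bal; have dl := ltn_ord d; apply/idP/idP => H; last first.
  apply: (@lt_le_trans _ _ (\sum_(i < l) (q + (i < d.+1)%N%:Z))).
    rewrite big_split /= sum_int_lt_ord // sumr_const card_ord -mulr_natr natz; lia.
  apply: ler_sum => i _; have [id|di] := ltnP i d.+1.
    by have := bal i d id; lia.
  by have := bal d i (ltnW di); lia.
rewrite ltNge; apply/negP => bq; move: H; rewrite ltNge => /negP; apply.
apply: (@le_trans _ _ (\sum_(i < l) (q + (i < d)%N%:Z))).
  apply: ler_sum => i _; have [id|di] := ltnP i d.
    by have := bal i d (ltnW id); lia.
  by have := bal d i di; lia.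
rewrite big_split /= sum_int_lt_ord ?(ltnW dl) // sumr_const card_ord -mulr_natr natz; lia.
Qed.

Lemma sum_delta (n : nat) (i0 : 'I_n) (x : int) :
  \sum_(i < n) (if i == i0 then x else 0) = x.
Proof. by rewrite -big_mkcond big_pred1_eq. Qed.

(** Only row [i0] and column [j0] are nonzero; the corner entry absorbs the
    total [m] counted twice. *)
Lemma matrix_margins (p q : nat) (m : int) (r : 'I_p -> int) (t : 'I_q -> int) :
  (0 < p)%N -> (0 < q)%N -> \sum_i r i = m -> \sum_j t j = m ->
  exists a : 'I_p -> 'I_q -> int,
    (forall i, \sum_j a i j = r i) /\ (forall j, \sum_i a i j = t j).
Proof.
move=> p0 q0 rm tm; pose i0 := Ordinal p0; pose j0 := Ordinal q0.
exists (fun i j => (if j == j0 then r i - (if i == i0 then m else 0) else 0)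
                   + (if i == i0 then t j else 0)).
split=> [i|j]; rewrite big_split /= sum_delta.
  by case: eqP => _; rewrite ?tm ?subrK // big1 // subr0 addr0.
case: eqP => _; last by rewrite big1 // add0r.
by rewrite big_split /= sumrN sum_delta rm subrr add0r.
Qed.

Lemma tau_l_exists (e l : nat) (m : int) (la : Defs.partition) (s : multicharge l) :
  (forall d : 'I_l, charged (@column e l m la d) (s (rev_ord d))) ->
  exists mu : multipartition l, is_tau_l e m la (mu, s).
Proof.
move=> H.
have /choice[mu muE] i : exists mu, symbol (s i) mu = @column e l m la (rev_ord i).
  by apply: symbol_of_charged; rewrite -{2}[i]rev_ordK.
by exists [ffun i => mu i] => i; rewrite /multisymbol /= ffunE.
Qed.

Lemma tau_e_exists (e : nat) (m : int) (la : Defs.partition) (t : multicharge e) :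
  (forall c : 'I_e, charged (slice (symbol m la) c) (t c)) ->
  exists mu : multipartition e, is_tau_e m la (mu, t).
Proof.
move=> H.
have /choice[mu muE] c : exists mu, symbol (t c) mu = slice (symbol m la) c.
  exact: symbol_of_charged.
exists [ffun i => mu i] => c; rewrite /multisymbol /= ffunE muE.
by rewrite /slice; apply/seteqP; split=> k /=; rewrite mulrC.
Qed.

(** The runner charges of the core sought are the row sums of [b]. Position
    [i] must exceed position [0] by [s i - s0], a number between [0] and [e]
    that grows with [i]: the first [s i - s0] rows contribute one unit each.
    The common part [s0] is put in row [c0]. *)
Lemma alcove_balanced_matrix (e l : nat) (m : int) (s : multicharge l) :
  (0 < e)%N -> (0 < l)%N -> @closed_alcove e l m s ->
  exists b : 'I_e -> 'I_l -> int,
    (forall d, \sum_c b c d = s (rev_ord d)) /\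
    (forall c (i j : 'I_l), (i <= j)%N -> b c j <= b c i <= b c j + 1).
Proof.
move=> e0 l0 [_ alc]; pose c0 := Ordinal e0; pose s0 := s (Ordinal l0).
have gap (i j : 'I_l) : (i <= j)%N -> 0 <= s j - s i <= e%:Z.
  by rewrite leq_eqVlt => /orP[/eqP/val_inj->|/alc//]; lia.
have gap0 i : 0 <= s i - s0 <= e%:Z by exact: gap.
exists (fun c d => (if c == c0 then s0 else 0)
                   + (c < `|(s (rev_ord d) - s0)%R|)%N%:Z); split=> [d|c i j ij].
  rewrite big_split /= sum_delta sum_int_lt_ord; last by have := gap0 (rev_ord d); lia.
  by have := gap0 (rev_ord d); lia.
have := gap (rev_ord j) (rev_ord i) ltac:(rewrite /=; lia).
have := gap0 (rev_ord j); have := gap0 (rev_ord i).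
set x := s (rev_ord i); set y := s (rev_ord j); clearbody x y => Hx Hy Hxy.
have : (`|(y - s0)%R| <= `|(x - s0)%R|)%N by lia.
move: `|(y - s0)%R|%N `|(x - s0)%R|%N => u v uv.
by case: ltnP => ?; case: ltnP => ?; lia.
Qed.

Theorem mainTheorem7 (e l : nat) (he : (2 <= e)%N) (hl : (1 <= l)%N) (m : int)
    (s : multicharge l) (hs : charges m s) :
  [set s' : multicharge l |
    exists (la : multipartition l) (n : nat) (mu : multipartition l),
      total_size mu = n /\ is_ecore e m (mu, s) (la, s')]
  = @closed_alcove e l m.
Proof.
have e0 : (0 < e)%N by exact: ltnW.
apply/seteqP; split=> [s' [la [n [mu [_ [lam [ka [mu_e [t [_ _ te tl]]]]]]]]]|s' Hs'].
  exact: (ecore_charge_alcove e0 hl te tl).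
have rev_sum (u : multicharge l) : \sum_d u (rev_ord d) = \sum_i u i.
  by rewrite [RHS](reindex_inj rev_ord_inj).
have [b [bcol bbal]] := alcove_balanced_matrix e0 hl Hs'.
pose t : multicharge e := [ffun c => \sum_d b c d].
have tm : \sum_c t c = m.
  under eq_bigr => c _ do rewrite ffunE.
  rewrite exchange_big /=; under eq_bigr => d _ do rewrite bcol.
  by rewrite rev_sum; case: Hs'.
have sm : \sum_d s (rev_ord d) = m.
  by rewrite rev_sum.
(* Pieces of charges [a c d] make runners of charges [t] and columns of
   charges [s]. *)
have [a [arow acol]] := matrix_margins e0 hl tm sm.
have [ka kaE] : exists ka, symbol m ka = interleave (fun c : 'I_e => [set k | k < t c]).
  by apply: symbol_of_charged; rewrite -tm; apply: charged_interleave => // c; exact: charged_lt.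
pose run c := interleave (fun d : 'I_l => [set q | q < a c d]).
have Hrun c : charged (run c) (t c).
  by rewrite -arow; apply: charged_interleave => // d; exact: charged_lt.
have [lam lamE] : exists lam, symbol m lam = interleave run.
  by apply: symbol_of_charged; rewrite -tm; exact: charged_interleave.
have [mu_e Hmu_e] : exists mu_e, is_tau_e m lam (mu_e, t).
  by apply: tau_e_exists => c; rewrite lamE interleaveK.
have [mu Hmu] : exists mu, is_tau_l e m lam (mu, s).
  apply: tau_l_exists => d; rewrite columnE -acol.
  apply: charged_interleave => // c.
  by rewrite lamE interleaveK interleaveK; exact: charged_lt.
have [la Hla] : exists la, is_tau_l e m ka (la, s').
  apply: tau_l_exists => d; rewrite columnE -bcol.
  apply: charged_interleave => // c; rewrite kaE interleaveK.
  have -> : slice [set k | k < t c] d = [set q | q < b c d].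
    apply/seteqP; split=> q; rewrite /slice /= ffunE balanced_interleave //; exact: bbal.
  exact: charged_lt.
(* Both [lam] and [ka] have runner charges [t], so [ka] is the core of [lam]. *)
exists la, (total_size mu), mu; split=> //.
exists lam, ka, mu_e, t; split=> //.
move=> c; rewrite /multisymbol /= [empty_multipartition e c]ffunE symbol_empty.
rewrite -[LHS](interleaveK (fun c : 'I_e => [set k | k < t c])) -kaE /slice /=.
by apply/seteqP; split=> k /=; rewrite mulrC.
Qed.
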